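(* Let $(W,S)$ be a Coxeter system with $S$ finite and let $\theta$ be an involutive automorphism of $(W,S)$. Suppose $\theta$ has the no odd flip (NOF) property. Then the poset $\mathrm{Br}(\iota(\theta))$ is graded with rank function $\rho$.
   Context: A Coxeter system $(W,S)$ has length function $\ell$, identity $e$, and $m(s,s')$ denotes the (possibly infinite) order of $ss'$. An automorphism of $(W,S)$ is a group automorphism of $W$ mapping $S$ onto $S$; $\theta$ is involutive if $\theta^2=\mathrm{id}$. The set of twisted involutions is $\mathfrak{I}(\theta)=\{w\in W\mid \theta(w)=w^{-1}\}$, and the set of twisted identities is $\iota(\theta)=\{\theta(w^{-1})w\mid w\in W\}\subseteq \mathfrak{I}(\theta)$. For $w\in W$ and $s\in S$ define $w\star s=ws$ if $\theta(s)ws=w$, and $w\star s=\theta(s)ws$ otherwise; write $w\star s_1\star\cdots\star s_k$ for iterated application (left to right). Every twisted involution has the form $e\star s_1\star\cdots\star s_k$; $\rho(w)$ denotes the minimal such $k$. The Bruhat order on $W$: $u\le v$ iff for every reduced expression $s_1\cdots s_k$ of $v$ there are $i_1<\cdots<i_m$ with $u=s_{i_1}\cdots s_{i_m}$. For $X\subseteq W$, $\mathrm{Br}(X)$ is the induced subposet of the Bruhat order on $X$. $\theta$ has the NOF property if $m(s,\theta(s))$ is even or infinite for every $s\in S$ with $s\ne\theta(s)$. A locally finite poset with a minimum element is graded if in every interval all maximal chains have the same cardinality; ''graded with rank function $\rho$'' means moreover that the rank of each element (length of any maximal chain from the minimum) equals $\rho$. *)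

(* Defs.v *)
From mathcomp Require Import all_boot.
From mathcomp Require Import boolp classical_sets functions cardinality.

Set Implicit Arguments.
Unset Strict Implicit.
Unset Printing Implicit Defensive.

Local Open Scope classical_set_scope.
Local Open Scope card_scope.
Local Open Scope group_scope.

Section Order.
Variable G : groupType.
Implicit Type x : G.

Definition has_order x (n : nat) : Prop :=
  [/\ (0 < n)%N, x ^+ n = 1 & forall k, (0 < k < n)%N -> x ^+ k <> 1].

Definition infinite_order x : Prop := forall n, (0 < n)%N -> x ^+ n <> 1.

End Order.

Section Coxeter.
Variables (W : groupType) (S : set W).
Implicit Types (r : seq W) (w : W) (theta : W -> W).

Definition word r : Prop := [set` r] `<=` S.

Definition word_prod r : W := \prod_(s <- r) s.

(* The congruence on the free monoid on S generated by
   (s t)^m(s,t) ~ empty word, for all s, t in S with m(s,t) finite.  Taking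
   s = t, where m(s,s) = 1, gives s s ~ empty word, so each letter is its own
   inverse and the quotient of the free monoid is the group
   < S | (s t)^m(s,t) >. *)
Inductive word_equiv : seq W -> seq W -> Prop :=
| word_equiv_refl r : word_equiv r r
| word_equiv_sym r1 r2 : word_equiv r1 r2 -> word_equiv r2 r1
| word_equiv_trans r1 r2 r3 :
    word_equiv r1 r2 -> word_equiv r2 r3 -> word_equiv r1 r3
| word_equiv_insert r1 r2 s t n :
    S s -> S t -> has_order (s * t) n ->
    word_equiv (r1 ++ r2) (r1 ++ flatten (nseq n [:: s; t]) ++ r2).

Record coxeter_system : Prop := CoxeterSystem {
  coxeter_order2 : forall s, S s -> has_order s 2;
  coxeter_generate : forall w, exists2 r, word r & word_prod r = w;
  coxeter_presentation : forall r1 r2, word r1 -> word r2 ->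
    word_prod r1 = word_prod r2 -> word_equiv r1 r2 }.

Definition reduced_expression w r : Prop :=
  [/\ word r, word_prod r = w &
      forall r', word r' -> word_prod r' = w -> (size r <= size r')%N].

Definition bruhat (u v : W) : Prop :=
  forall r, reduced_expression v r ->
    exists2 r', subseq r' r & word_prod r' = u.

Definition coxeter_automorphism theta : Prop :=
  bijective theta /\ theta @` S = S.

Definition NOF theta : Prop :=
  forall s, S s -> s <> theta s ->
    infinite_order (s * theta s) \/
    exists2 n, has_order (s * theta s) n & ~~ odd n.

Definition twisted_identities theta : set W :=
  [set theta (w^-1) * w | w in [set: W]].

Definition star theta w s : W :=
  if theta s * w * s == w then w * s else theta s * w * s.

Definition star_expression theta w r : Prop :=
  word r /\ foldl (star theta) 1 r = w.

(* The default value 0 is only taken when w has no expression of the form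
   e * s_1 * ... * s_k, which does not happen when theta w = w^-1. *)
Definition rho theta w : nat :=
  xget 0%N [set k | (exists2 r, star_expression theta w r & size r = k) /\
                    forall r, star_expression theta w r -> (k <= size r)%N].

End Coxeter.

(* Subposets are given by a carrier X and an ambient relation le. *)
Section Graded.
Variables (T : Type) (X : set T) (le : T -> T -> Prop).
Implicit Types (u v : T) (C : set T).

Definition partial_order_on : Prop :=
  [/\ forall x, X x -> le x x,
      forall x y, X x -> X y -> le x y -> le y x -> x = y &
      forall x y z, X x -> X y -> X z -> le x y -> le y z -> le x z].

Definition interval u v : set T := [set x | [/\ X x, le u x & le x v]].

Definition minimum u : Prop := X u /\ forall x, X x -> le u x.

Definition chain_of A C : Prop := C `<=` A /\ total_on C le.

Definition maximal_chain u v C : Prop :=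
  chain_of (interval u v) C /\
  forall D, chain_of (interval u v) D -> C `<=` D -> D = C.

Definition locally_finite : Prop :=
  forall u v, X u -> X v -> finite_set (interval u v).

Definition graded : Prop :=
  [/\ partial_order_on, locally_finite, exists u, minimum u &
      forall u v C D, X u -> X v -> le u v ->
        maximal_chain u v C -> maximal_chain u v D -> C #= D].

(* A chain with k + 1 elements has length k. *)
Definition graded_with_rank (rank : T -> nat) : Prop :=
  graded /\
  forall u x C, minimum u -> X x -> maximal_chain u x C ->
    C #= `I_(rank x).+1.

End Graded.

(* Main.v *)
(* On twisted identities the Bruhat rank is half the length. Since
   theta(s) w s is shorter than w = theta(x^-1) x by two whenever s is a descent
   that does not satisfy theta(s) w = w s, everything hinges on the last
   condition, which says that the reflection x s x^-1 is fixed by theta. The NOF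
   property enters only through the fact that every theta-fixed reflection is
   conjugate, by a theta-fixed element, to a theta-fixed simple reflection. It
   implies that theta(s) w = w s never happens at a descent, and that if t is a
   theta-fixed reflection and y an involution with theta(y) = t y t, then
   theta(y) = y. Coatoms of intervals are then found by the usual induction with
   the lifting property; the only obstruction would be a pair a < b of twisted
   identities, of lengths n and n + 2, with a common ascent s such that
   theta(s) b = b s but theta(s) a <> a s, and the second consequence excludes it.

   Inversions are taken on the left: t is an inversion of w when t w is shorter
   than w. For twisted involutions, s is a right descent iff theta s is a left
   descent, so in terms of a = theta s the doubled step is w -> a w theta(a). *)
Require Import Defs.
From mathcomp Require Import all_boot.
From mathcomp Require Import boolp classical_sets functions cardinality.
From mathcomp Require Import zify.

Set Implicit Arguments.
Unset Strict Implicit.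
Unset Printing Implicit Defensive.

Local Open Scope classical_set_scope.
Local Open Scope card_scope.
Local Open Scope group_scope.

(** * Words and their inversions *)

Section Words.
Variables (W : groupType) (S : set W).
Implicit Types (r : seq W) (s t u v w x : W).

Lemma word_nil : word S [::].
Proof. by []. Qed.

Lemma word_cons s r : word S (s :: r) <-> S s /\ word S r.
Proof.
split=> [sr | [Ss Sr] x /=]; last by rewrite inE => /predU1P[->|/Sr].
by split=> [|x xr]; apply: sr; rewrite /= ?mem_head // inE xr orbT.
Qed.

Lemma word_cat r1 r2 : word S (r1 ++ r2) <-> word S r1 /\ word S r2.
Proof.
elim: r1 => [|s r IH] /=; first by split=> // -[].
by rewrite !word_cons IH; tauto.
Qed.

Lemma word_rev r : word S r -> word S (rev r).
Proof. by move=> Sr x /=; rewrite mem_rev => /Sr. Qed.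

Lemma word_prod_nil : word_prod [::] = 1 :> W.
Proof. by rewrite /word_prod big_nil. Qed.

Lemma word_prod_cons s r : word_prod (s :: r) = s * word_prod r.
Proof. by rewrite /word_prod big_cons. Qed.

Lemma word_prod_cat r1 r2 : word_prod (r1 ++ r2) = word_prod r1 * word_prod r2.
Proof. by rewrite /word_prod big_cat. Qed.

Lemma word_prod_nseq n s t :
  word_prod (flatten (nseq n [:: s; t])) = (s * t) ^+ n.
Proof.
elim: n => [|n IH]; first by rewrite word_prod_nil.
by rewrite /= !word_prod_cons IH expgS mulgA.
Qed.

Lemma eq_conjg x y z : (x ^ z == y) = (x == y ^ z^-1).
Proof. by apply/eqP/eqP => [<-|->]; rewrite -conjgM (mulgV, mulVg) conjg1. Qed.

(* For a word r = s_1 ... s_k, the parity of the number of i such that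
   t = s_1 ... s_i ... s_1. *)
Fixpoint word_inversion r t : bool :=
  if r is s :: r' then (t == s) (+) word_inversion r' (t ^ s) else false.

Lemma word_inversion_cat r1 r2 t : word_inversion (r1 ++ r2) t =
  word_inversion r1 t (+) word_inversion r2 (t ^ word_prod r1).
Proof.
elim: r1 t => [|s r IH] t /=; first by rewrite word_prod_nil conjg1.
by rewrite IH word_prod_cons conjgM addbA.
Qed.

(** Counting from 0, the prefix of length j + 1 of the alternating word yields the reflection
    [(s * t) ^+ j * s]. *)
Lemma word_inversion_nseq n s t x : s * s = 1 -> t * t = 1 ->
  word_inversion (flatten (nseq n [:: s; t])) x =
  \big[addb/false]_(j < n.*2) (x == (s * t) ^+ j * s).
Proof.
move=> ss tt; have sV : s^-1 = s by apply: mulg1_eq.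
have tV : t^-1 = t by apply: mulg1_eq.
elim: n x => [|n IH] x; first by rewrite big_ord0.
rewrite doubleS !big_ord_recl /= IH mul1g; congr (_ (+) _).
rewrite eq_conjg sV conjgE sV mulgA; congr (_ (+) _).
apply: eq_bigr => j _; rewrite -conjgM eq_conjg; congr (_ == _).
by rewrite conjgE invgK /bump !add1n expgS expgSr invgM sV tV !mulgA.
Qed.

End Words.

(** * Length and exchange *)

Section CoxeterLength.
Variables (W : groupType) (S : set W).
Hypothesis cox : coxeter_system S.
Implicit Types (r : seq W) (s t u v w x y : W).

Lemma simple_sqr s : S s -> s * s = 1.
Proof. by case/(coxeter_order2 cox). Qed.

Lemma simple_neq1 s : S s -> s <> 1.
Proof. by case/(coxeter_order2 cox) => _ _ /(_ 1%N isT). Qed.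

Lemma simpleV s : S s -> s^-1 = s.
Proof. by move=> /simple_sqr/mulg1_eq. Qed.

Lemma simpleK s w : S s -> s * (s * w) = w.
Proof. by move=> /simple_sqr ss; rewrite mulgA ss mul1g. Qed.

Lemma simpleKr s w : S s -> w * s * s = w.
Proof. by move=> /simple_sqr ss; rewrite -mulgA ss mulg1. Qed.

Lemma word_prod_rev r : word S r -> word_prod (rev r) = (word_prod r)^-1.
Proof.
elim: r => [|s r IH]; first by rewrite word_prod_nil invg1.
move=> /word_cons[Ss Sr]; rewrite rev_cons -cats1 word_prod_cat !word_prod_cons.
by rewrite word_prod_nil mulg1 IH // invgM (simpleV Ss).
Qed.

(** As [(s * t) ^+ n = 1], the indices j and j + n give the same reflection, so everything cancels
    in pairs. Hence the parity is invariant under the defining relations and descends to [W]. *)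
Lemma word_inversion_relation n s t x : S s -> S t -> (s * t) ^+ n = 1 ->
  word_inversion (flatten (nseq n [:: s; t])) x = false.
Proof.
move=> /simple_sqr ss /simple_sqr tt stn.
rewrite word_inversion_nseq // -addnn big_split_ord /=.
set a := (X in X (+) _); rewrite [X in a (+) X](_ : _ = a) ?addbb //.
by apply: eq_bigr => j _; rewrite expgnDr stn mul1g.
Qed.

Lemma word_equiv_inversion r1 r2 : word_equiv S r1 r2 ->
  word_inversion r1 =1 word_inversion r2 /\ word_prod r1 = word_prod r2.
Proof.
elim=> {r1 r2} [r|r1 r2 _ [IH1 IH2]|r1 r2 r3 _ [IH1 IH2] _ [IH3 IH4]|].
- by [].
- by split=> // x; rewrite IH1.
- by split=> [x|]; rewrite (IH1, IH2) (IH3, IH4).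
- move=> r1 r2 s t n Ss St [_ stn _]; split=> [x|].
    rewrite !word_inversion_cat word_inversion_relation //= word_prod_nseq stn.
    by rewrite conjg1.
  by rewrite !word_prod_cat word_prod_nseq stn mul1g.
Qed.

Lemma ex_word w : exists r, word S r /\ word_prod r = w.
Proof. by have [r] := coxeter_generate cox w; exists r. Qed.

Definition some_word w : seq W := projT1 (cid (ex_word w)).

Lemma some_wordP w : word S (some_word w) /\ word_prod (some_word w) = w.
Proof. by rewrite /some_word; case: cid. Qed.

(* For a reflection t, this holds iff t w is shorter than w. *)
Definition inversion w t : bool := word_inversion (some_word w) t.

Lemma inversion_word r t : word S r ->
  inversion (word_prod r) t = word_inversion r t.
Proof.
move=> Sr; have [Sr' e] := some_wordP (word_prod r).
by have [/(_ t)] := word_equiv_inversion (coxeter_presentation cox Sr' Sr e).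
Qed.

(** The cocycle rule, inherited from concatenation of words; it encodes the action of [W] on signed
    reflections. *)
Lemma inversionM u v t : inversion (u * v) t = inversion u t (+) inversion v (t ^ u).
Proof.
have [[r1 Sr1 <-] [r2 Sr2 <-]] := (coxeter_generate cox u, coxeter_generate cox v).
rewrite -word_prod_cat !inversion_word ?word_inversion_cat //.
by rewrite word_cat.
Qed.

Lemma inversion1 t : inversion 1 t = false.
Proof. by rewrite -word_prod_nil inversion_word. Qed.

Lemma inversion_simple s t : S s -> inversion s t = (t == s).
Proof.
move=> Ss; have -> : s = word_prod [:: s] by rewrite word_prod_cons word_prod_nil mulg1.
rewrite inversion_word; last by apply/word_cons.
by rewrite word_prod_cons word_prod_nil mulg1 /= addbF.
Qed.

Lemma inversionV w t : inversion w^-1 t = inversion w (t ^ w^-1).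
Proof.
by have := inversionM w^-1 w t; rewrite mulVg inversion1; do 2 case: inversion.
Qed.

Definition reflection t : Prop := exists2 s, S s & exists x, t = s ^ x.

Lemma simple_reflection s : S s -> reflection s.
Proof. by move=> Ss; exists s => //; exists 1; rewrite conjg1. Qed.

Lemma reflectionJ t x : reflection t -> reflection (t ^ x).
Proof. by case=> s Ss [y ->]; exists s => //; exists (y * x); rewrite conjgM. Qed.

Lemma reflection_sqr t : reflection t -> t * t = 1.
Proof. by case=> s Ss [x ->]; rewrite -conjMg simple_sqr // conj1g. Qed.

Lemma reflectionV t : reflection t -> t^-1 = t.
Proof. by move/reflection_sqr/mulg1_eq. Qed.

Lemma reflectionK t w : reflection t -> t * (t * w) = w.
Proof. by move=> /reflection_sqr ss; rewrite mulgA ss mul1g. Qed.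

(* Writing t = p ^ x with p simple, the contributions of x and x^-1 to the
   inversions of t cancel on elements commuting with t. *)
Lemma inversion_commute t u : reflection t -> u ^ t = u ->
  inversion t u = (u == t).
Proof.
case=> p Sp [x ->] c; rewrite {1}conjgE !inversionM.
have e : (u ^ x^-1) ^ p = u ^ x^-1.
  by apply: (@conjg_inj _ x); rewrite -!conjgM -conjgE c mulVg conjg1.
rewrite e (inversion_simple _ Sp) inversionV eq_conjg invgK.
by case: inversion; case: eqP.
Qed.

Lemma inversion_id t : reflection t -> inversion t t.
Proof.
move=> rt; rewrite inversion_commute //.
by rewrite conjgE mulKg.
Qed.

Lemma inversion_reflM t w : reflection t -> inversion (t * w) t = ~~ inversion w t.
Proof.
by move=> rt; rewrite inversionM inversion_id // conjgE mulKg addTb.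
Qed.

(** Strong exchange: an odd parity forces some prefix reflection to equal [t], and the matching
    letter is deleted. The inclusion of letters keeps the new word in any parabolic subgroup that
    contains the letters of the old one. *)
Lemma word_exchange r t : word S r -> word_inversion r t ->
  exists r', [/\ word S r', {subset r' <= r}, word_prod r' = t * word_prod r &
    size r = (size r').+1].
Proof.
elim: r t => [//|s r IH] t /word_cons[Ss Sr] /=.
case: eqP => [-> _|ne].
  exists r; split=> //; last by rewrite word_prod_cons simpleK.
  by move=> x xr; rewrite inE xr orbT.
move=> /= /(IH _ Sr) [r' [Sr' sub e sz]]; exists (s :: r'); split=> //=.
- exact/word_cons.
- by move=> x; rewrite !inE => /predU1P[->|/sub->]; rewrite ?eqxx ?orbT.
- by rewrite !word_prod_cons e conjgE simpleV // -!mulgA simpleK.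
- by rewrite sz.
Qed.

Lemma ex_word_size w :
  exists n, `[< exists r, [/\ word S r, word_prod r = w & size r = n] >].
Proof. by have [r [? ?]] := ex_word w; exists (size r); apply/asboolP; exists r. Qed.

Definition len w : nat := ex_minn (ex_word_size w).

Lemma ex_reduced w : exists r, [/\ word S r, word_prod r = w & size r = len w].
Proof. by rewrite /len; case: ex_minnP => n /asboolP. Qed.

Lemma len_word r : word S r -> (len (word_prod r) <= size r)%N.
Proof.
move=> Sr; rewrite /len; case: ex_minnP => n _; apply.
by apply/asboolP; exists r.
Qed.

Lemma reduced_expressionP w r :
  reduced_expression S w r <-> [/\ word S r, word_prod r = w & size r = len w].
Proof.
split=> [[Sr e m]|[Sr e sz]]; split=> //; last first.
  by move=> r' Sr' er; rewrite sz -er len_word.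
have [r' [Sr' e' sz]] := ex_reduced w; apply/eqP; rewrite eqn_leq -{2}e len_word //.
by rewrite -sz m.
Qed.

Lemma len_eq0 w : (len w == 0)%N = (w == 1).
Proof.
apply/eqP/eqP => [|->]; last first.
  by apply/eqP; rewrite -leqn0 -word_prod_nil len_word.
by have [r [_ <- <-]] := ex_reduced w; move/size0nil->; rewrite word_prod_nil.
Qed.

Lemma lenV w : len w^-1 = len w.
Proof.
wlog: w / (len w <= len w^-1)%N => [H|].
  case/orP: (leq_total (len w) (len w^-1)) => h; first exact: H.
  by rewrite -{2}[w]invgK (H w^-1) ?invgK.
move=> le; apply/eqP; rewrite eqn_leq le andbT.
have [r [Sr e <-]] := ex_reduced w.
by rewrite -e -word_prod_rev // -(size_rev r) len_word //; apply: word_rev.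
Qed.

Lemma lenM u v : (len (u * v) <= len u + len v)%N.
Proof.
have [r1 [S1 e1 <-]] := ex_reduced u; have [r2 [S2 e2 <-]] := ex_reduced v.
by rewrite -e1 -e2 -word_prod_cat -size_cat len_word // word_cat.
Qed.

Lemma inversion_len w t : inversion w t -> (len (t * w) < len w)%N.
Proof.
have [r [Sr <- <-]] := ex_reduced w; rewrite inversion_word //.
by move=> /(word_exchange Sr)[r' [Sr' _ <- ->]]; rewrite ltnS len_word.
Qed.

(** Multiplication by [t] flips whether [t] is an inversion, so exchange shortens either [w] or
    [t * w]. *)
Lemma len_refl t w : reflection t -> (len (t * w) < len w)%N = inversion w t.
Proof.
move=> rt; apply/idP/idP; last exact: inversion_len.
apply: contraTT => ni; rewrite -leqNgt ltnW // -{1}(reflectionK w rt).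
by rewrite inversion_len // inversion_reflM.
Qed.

Lemma len_refl_gt t w : reflection t -> (len w < len (t * w))%N = ~~ inversion w t.
Proof.
by move=> rt; rewrite -(inversion_reflM w rt) -len_refl // reflectionK.
Qed.

Lemma len_simple s : S s -> len s = 1%N.
Proof.
move=> Ss; apply/eqP; rewrite eqn_leq lt0n len_eq0; apply/andP; split.
  rewrite -[s]mulg1 -word_prod_nil -word_prod_cons.
  by apply: (@len_word [:: s]); apply/word_cons.
by apply/eqP; apply: simple_neq1.
Qed.

Lemma len_simpleM s w : S s ->
  if inversion w s then len w = (len (s * w)).+1 else len (s * w) = (len w).+1.
Proof.
move=> Ss; have rs := simple_reflection Ss.
have h1 := lenM s w; have h2 := lenM s (s * w).
rewrite simpleK // in h2; rewrite !(len_simple Ss) in h1 h2.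
have := len_refl w rs; have := len_refl_gt w rs.
case: inversion => /=; lia.
Qed.

Lemma ex_left_descent w : w <> 1 -> exists2 s, S s & inversion w s.
Proof.
have [[|s r] [Sr <- sz]] := ex_reduced w; first by rewrite word_prod_nil.
move=> _; have /word_cons[Ss Sr'] := Sr; exists s => //.
rewrite -len_refl; last exact: simple_reflection.
by rewrite -sz word_prod_cons simpleK //= ltnS len_word.
Qed.

Lemma inversion_mul_simple s w s' : S s -> S s' -> s * w <> w * s' ->
  inversion (w * s') s = inversion w s.
Proof.
move=> Ss Ss' ne; rewrite inversionM (inversion_simple _ Ss').
case: eqP => [e|]; last by rewrite addbF.
by case: ne; rewrite -e conjgE mulVKg.
Qed.

(** Since [s * w] and [w * s'] differ, [s] is a left descent of [w * s'] exactly when it is one of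
    [w]; the two multiplications therefore move the length in the same direction. *)
Lemma len_two_sided s w s' : S s -> S s' -> s * w <> w * s' ->
  len (s * w) = len (w * s') ->
  if inversion w s then len w = (len (s * w * s') + 2)%N
  else len (s * w * s') = (len w + 2)%N.
Proof.
move=> Ss Ss' ne e; have := len_simpleM w Ss.
have := len_simpleM (w * s') Ss; rewrite (inversion_mul_simple Ss Ss' ne) mulgA.
by case: inversion => h1 h2; [rewrite h2 e h1 addn2 | rewrite h1 -e h2 addn2].
Qed.

End CoxeterLength.

(** * The Bruhat order *)

Section BruhatOrder.
Variables (W : groupType) (S : set W).
Hypothesis cox : coxeter_system S.
Implicit Types (r : seq W) (s t u v w x y : W).
Local Notation len := (len cox).
Local Notation inversion := (inversion cox).
Local Notation reflection := (reflection S).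

(** The Bruhat order as generated by length-increasing reflections. Left multiplication suffices
    because u t = (u t u^-1) u. [bruhatP] identifies it with the subword order. *)
Inductive chain_le : W -> W -> Prop :=
| chain_le_refl u : chain_le u u
| chain_le_step t u w : reflection t -> ~~ inversion u t ->
    chain_le (t * u) w -> chain_le u w.

Lemma chain_le_trans v u w : chain_le u v -> chain_le v w -> chain_le u w.
Proof. by elim=> // t {}u {}v rt ni _ IH /IH; exact: chain_le_step. Qed.

Lemma chain_le_simple s u : S s -> ~~ inversion u s -> chain_le u (s * u).
Proof.
move=> /simple_reflection rs ni.
by apply: (chain_le_step rs ni); exact: chain_le_refl.
Qed.

Lemma chain_le_descent s u : S s -> inversion u s -> chain_le (s * u) u.
Proof.
move=> Ss iu; rewrite -{2}(simpleK cox u Ss); apply: chain_le_simple => //.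
by rewrite (inversion_reflM cox _ (simple_reflection Ss)) iu.
Qed.

Lemma chain_le_len u w : chain_le u w -> (len u <= len w)%N.
Proof.
elim=> // t {}u {}w rt ni _; apply: leq_trans.
by rewrite ltnW // (len_refl_gt cox _ rt).
Qed.

Lemma chain_le_len_eq u w : chain_le u w -> (len w <= len u)%N -> u = w.
Proof.
case=> // t {}u {}w rt ni /chain_le_len h1 h2.
by have := leq_trans h1 h2; rewrite leqNgt (len_refl_gt cox _ rt) ni.
Qed.

Lemma chain_le_cover u w : chain_le u w -> len w = (len u).+1 ->
  exists2 t, reflection t & w = t * u.
Proof.
case=> [{}u /n_Sn//|t {}u {}w rt ni h e]; exists t => //.
apply/esym/(chain_le_len_eq h).
by rewrite e (len_refl_gt cox _ rt).
Qed.

(** Here [s * (t * u) = t ^ s * (s * u)], and conjugation by [s] keeps the step increasing except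
    when [t] is [s]. *)
Lemma chain_step_simple s t u : S s -> reflection t -> ~~ inversion u t ->
  chain_le (s * u) (s * (t * u)) \/ s * u = t * u.
Proof.
move=> Ss rt ni; have [->|ne] := eqVneq t s; [by right|left].
apply: (@chain_le_step (t ^ s)); first exact: reflectionJ.
  rewrite (inversionM cox) (inversion_simple cox _ Ss) -conjgM.
  rewrite (simple_sqr cox Ss) conjg1 (negPf ni) addbF eq_conjg (simpleV cox Ss).
  by rewrite conjgE mulKg.
rewrite conjgE (simpleV cox Ss) -!mulgA (simpleK cox) //.
exact: chain_le_refl.
Qed.

(** Lifting property as a dichotomy, by induction along the chain: a step by [s] itself exchanges
    the two alternatives. The next three lemmas specialise it to given descents. *)
Lemma chain_le_lift s u w : S s -> chain_le u w ->
  chain_le (s * u) (s * w) \/ chain_le (s * u) w /\ chain_le u (s * w).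
Proof.
move=> Ss; elim=> [{}u|t {}u {}w rt ni h IH]; first by left; exact: chain_le_refl.
have stp := chain_le_step rt ni.
case: (chain_step_simple Ss rt ni) => [su|e].
  case: IH => [h1|[h1 h2]]; first by left; apply: chain_le_trans h1.
  by right; split; [apply: chain_le_trans h1|apply: stp].
rewrite -e (simpleK cox) // in IH h; case: IH => [h1|[h1 h2]]; last by left.
by right.
Qed.

Lemma chain_le_lift_notin s u w : S s -> chain_le u w ->
  ~~ inversion u s -> inversion w s ->
  chain_le u (s * w) /\ chain_le (s * u) w.
Proof.
move=> Ss h ni iw; case: (chain_le_lift Ss h) => [h1|[]//]; split.
  exact: chain_le_trans (chain_le_simple Ss ni) h1.
exact: chain_le_trans h1 (chain_le_descent Ss iw).
Qed.

Lemma chain_le_lift_in s u w : S s -> chain_le u w ->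
  inversion u s -> chain_le (s * u) (s * w).
Proof.
move=> Ss h iu; case: (chain_le_lift Ss h) => [//|[_]].
exact: chain_le_trans (chain_le_descent Ss iu).
Qed.

Lemma chain_le_mul s u w : S s -> chain_le u w ->
  ~~ inversion w s -> chain_le (s * u) (s * w).
Proof.
move=> Ss h iw; case: (chain_le_lift Ss h) => [//|[h1 _]].
exact: chain_le_trans h1 (chain_le_simple Ss iw).
Qed.

Lemma chain_leV u w : chain_le u w -> chain_le u^-1 w^-1.
Proof.
elim=> [{}u|t {}u {}w rt ni _ IH]; first exact: chain_le_refl.
have e : t ^ u * u^-1 = (t * u)^-1.
  by rewrite invgM (reflectionV cox rt) conjgE -!mulgA mulgV mulg1.
apply: (@chain_le_step (t ^ u)); last by rewrite e.
  exact: reflectionJ.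
by rewrite inversionV -conjgM mulgV conjg1.
Qed.

(** Induction on the reduced word. Its first letter is an ascent of the tail w, and lifting [u]
    below s w puts [s * u] or [u] below w, according to whether that letter is kept in the
    subword. *)
Lemma subword_chain_le r u : word S r -> size r = len (word_prod r) ->
  (exists2 r', subseq r' r & word_prod r' = u) <-> chain_le u (word_prod r).
Proof.
elim: r u => [|s r IH] u.
  move=> _ _; split=> [[[|//] _ <-]|]; first exact: chain_le_refl.
  rewrite word_prod_nil => /chain_le_len; rewrite leqNgt.
  rewrite (_ : len 1 = 0)%N; last by apply/eqP; rewrite len_eq0.
  by rewrite lt0n len_eq0 negbK => /eqP->; exists [::]; rewrite ?word_prod_nil.
move=> /word_cons[Ss Sr] sz; set w := word_prod r.
have iw : ~~ inversion w s.
  rewrite -(len_refl_gt cox _ (simple_reflection Ss)) -word_prod_cons -sz ltnS.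
  exact: len_word.
have {}sz : size r = len w.
  have := len_simpleM cox w Ss; rewrite (negPf iw) -word_prod_cons -sz.
  by case.
rewrite word_prod_cons -/w; split.
  case=> [[_ <-|x r' /= sub <-]].
    have h : chain_le 1 w.
      by apply/(IH 1 Sr sz); exists [::]; rewrite ?sub0seq ?word_prod_nil.
    by rewrite word_prod_nil; apply: chain_le_trans h (chain_le_simple Ss iw).
  case: eqP sub => [-> sub|_ sub].
    rewrite word_prod_cons; apply: chain_le_mul => //.
    by apply/(IH _ Sr sz); exists r'.
  have h : chain_le (word_prod (x :: r')) w by apply/(IH _ Sr sz); exists (x :: r').
  exact: chain_le_trans h (chain_le_simple Ss iw).
move=> /(chain_le_lift Ss); rewrite (simpleK cox) //.
case=> [|[_]] /(IH _ Sr sz)[r' sub e].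
  exists (s :: r'); rewrite /= ?eqxx // word_prod_cons e (simpleK cox) //.
exists r' => //; exact: subseq_trans sub (subseq_cons _ _).
Qed.

Lemma bruhatP u w : bruhat S u w <-> chain_le u w.
Proof.
split=> [b|h r /(reduced_expressionP cox)[Sr e sz]].
  have [r [Sr e sz]] := ex_reduced cox w.
  rewrite -e; apply/subword_chain_le; rewrite ?e //.
  by apply: b; apply/(reduced_expressionP cox).
by apply/(subword_chain_le u Sr); rewrite ?e.
Qed.

Lemma chain_le1 w : chain_le 1 w.
Proof.
apply/bruhatP => r _; exists [::]; first exact: sub0seq.
exact: word_prod_nil.
Qed.

Lemma finite_chain_le w : finite_set [set u | chain_le u w].
Proof.
have [r [Sr e sz]] := ex_reduced cox w.
pose B := [set word_prod (mask m r) | m in [set: (size r).-tuple bool]].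
apply: (@sub_finite_set _ _ B); last exact: finite_image.
move=> u; rewrite /= -e => /subword_chain_le[]; rewrite ?e //.
by move=> r' /subseqP[m /eqP sm ->] <-; exists (Tuple sm).
Qed.

End BruhatOrder.

(** * Reflections and rank two parabolic subgroups *)

Section Parabolic.
Variables (W : groupType) (S : set W).
Hypothesis cox : coxeter_system S.
Implicit Types (J : set W) (r : seq W) (d e s t u v w x y : W).
Local Notation len := (len cox).
Local Notation inversion := (inversion cox).
Local Notation reflection := (reflection S).

(** For [J] inside [S] this is a standard parabolic subgroup: its generators are involutions, so
    inverses of letters can be omitted. *)
Definition generated J w : Prop := exists2 r, word J r & word_prod r = w.

Lemma generated1 J : generated J 1.
Proof. by exists [::]; [exact: word_nil|exact: word_prod_nil]. Qed.

Lemma generatedM J u v : generated J u -> generated J v -> generated J (u * v).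
Proof.
by move=> [r1 J1 <-] [r2 J2 <-]; exists (r1 ++ r2); rewrite ?word_prod_cat ?word_cat.
Qed.

Lemma generated_letter J s : J s -> generated J s.
Proof.
move=> Js; exists [:: s]; first exact/word_cons.
by rewrite word_prod_cons word_prod_nil mulg1.
Qed.

Lemma generatedX J u n : generated J u -> generated J (u ^+ n).
Proof.
move=> Ju; elim: n => [|n IH]; first exact: generated1.
by rewrite expgS; apply: generatedM.
Qed.

Section Subset.
Variable J : set W.
Hypothesis JS : J `<=` S.

Lemma generatedV u : generated J u -> generated J u^-1.
Proof.
move=> [r Jr <-]; exists (rev r); first exact: word_rev.
by rewrite (word_prod_rev cox) //; apply: subset_trans Jr JS.
Qed.

Lemma generatedJ u v : generated J u -> generated J v -> generated J (u ^ v).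
Proof. by move=> Ju Jv; do !apply: generatedM => //; exact: generatedV. Qed.

Lemma generated_inversion d x : generated J d -> inversion d x -> generated J x.
Proof.
case=> r Jr <-; rewrite (inversion_word cox); last exact: subset_trans Jr JS.
elim: r x Jr => // s r IH x /word_cons[Js Jr] /=.
have gs := generated_letter Js.
case: eqP => [-> //|_ /= /(IH _ Jr) g].
by rewrite -(conjgK s x); apply/generatedJ/generatedV.
Qed.

(** If the first letter of a word is not a descent of its product, it is an inversion of the tail,
    and exchange gives a shorter word over [J] for the same element. *)
Lemma generated_eq1 d : generated J d -> (forall j, J j -> ~~ inversion d j) -> d = 1.
Proof.
case=> r Jr <-; have [n] := ubnP (size r); elim: n r Jr => // n IH [|j r] Jr.
  by rewrite word_prod_nil.
rewrite ltnS /= => sz ni; have /word_cons[Jj Jr'] := Jr.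
have Sr : word S r by apply: subset_trans JS.
have : word_inversion r j.
  have := ni j Jj; rewrite (inversion_word cox) /=; last exact: subset_trans Jr JS.
  by rewrite eqxx addTb negbK conjgE mulKg.
case/(word_exchange cox Sr) => r' [_ sub e rsz].
rewrite word_prod_cons -e; apply: IH; first by move=> x /= /sub/Jr'.
  by move: sz; rewrite rsz => /ltnW.
by move=> k /ni; rewrite e word_prod_cons.
Qed.

(** Take for y a shortest element of the coset of [w]. No reflection of the parabolic subgroup
    shortens y, so the cocycle rule leaves only the contribution of d. *)
Lemma coset_decomposition w : exists d y, [/\ generated J d, w = d * y,
  forall d', generated J d' -> (len y <= len (d' * y))%N &
  forall x, reflection x -> generated J x -> inversion w x = inversion d x].
Proof.
pose P n := `[< exists2 d, generated J d & len (d * w) = n >].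
have exP : exists n, P n.
  by exists (len w); apply/asboolP; exists 1; [exact: generated1|rewrite mul1g].
case: (ex_minnP exP) => n /asboolP[d Jd e] nmin.
have ymin d' : generated J d' -> (len (d * w) <= len (d' * (d * w)))%N.
  move=> Jd'; rewrite e; apply: nmin; apply/asboolP; exists (d' * d).
    exact: generatedM.
  by rewrite mulgA.
exists d^-1, (d * w); split; rewrite ?mulKg //; first exact: generatedV.
move=> x rx Jx; rewrite -{1}(mulKg d w) (inversionM cox).
rewrite -[RHS]addbF; congr addb; apply/negbTE.
rewrite -(len_refl cox); last exact: reflectionJ.
by rewrite -leqNgt; apply/ymin/generatedJ => //; exact: generatedV.
Qed.

(** Local minimality implies global minimality: the parabolic factor of [y] has no descent in [J],
    hence is trivial. *)
Lemma coset_minimal y : (forall j, J j -> ~~ inversion y j) ->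
  forall d, generated J d -> (len y <= len (d * y))%N.
Proof.
have [d [z [Jd -> zmin ez]]] := coset_decomposition y.
move=> ni; suff -> : d = 1 by rewrite mul1g.
apply: generated_eq1 => // j Jj; rewrite -ez; first exact: ni.
  exact/simple_reflection/JS.
exact: generated_letter.
Qed.

Lemma coset_minimal_inversion y x : (forall j, J j -> ~~ inversion y j) ->
  reflection x -> generated J x -> inversion y x = false.
Proof.
move=> ni rx Jx; apply/negbTE; rewrite -(len_refl cox) // -leqNgt.
exact: coset_minimal.
Qed.

End Subset.

(** * Dihedral subgroups generated by two simple reflections *)

Section Dihedral.
Variables s s' : W.
Hypotheses (Ss : S s) (Ss' : S s').

Lemma alternating_dihedral d : generated [set s; s'] d -> exists n,
  [\/ d = (s * s') ^+ n, d = (s' * s) ^+ n, d = s * (s' * s) ^+ n |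
      d = s' * (s * s') ^+ n].
Proof.
case=> r Jr <-; elim: r Jr => [_|x r IH /word_cons[Jx /IH[n H]]].
  by exists 0; rewrite word_prod_nil; apply: Or41.
rewrite word_prod_cons; case: Jx => ->; case: H => ->.
- case: n => [|n]; first by exists 0; apply: Or43.
  by exists n; rewrite expgS -!mulgA (simpleK cox) //; apply: Or44.
- by exists n; apply: Or43.
- by exists n; rewrite (simpleK cox) //; apply: Or42.
- by exists n.+1; rewrite mulgA -expgS; apply: Or41.
- by exists n; apply: Or44.
- case: n => [|n]; first by exists 0; apply: Or44.
  by exists n; rewrite expgS -!mulgA (simpleK cox) //; apply: Or43.
- by exists n.+1; rewrite mulgA -expgS; apply: Or42.
- by exists n; rewrite (simpleK cox) //; apply: Or41.
Qed.

Lemma mul_simpleV : (s * s')^-1 = s' * s.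
Proof. by rewrite invgM !(simpleV cox). Qed.

Lemma has_order_swap n : has_order (s * s') n -> has_order (s' * s) n.
Proof.
rewrite -mul_simpleV => -[n0 e m]; split=> //; first by rewrite expVgn e invg1.
by move=> k /m ne; rewrite expVgn => h; apply: ne; rewrite -[LHS]invgK h invg1.
Qed.

Lemma infinite_order_swap : infinite_order (s * s') -> infinite_order (s' * s).
Proof.
rewrite -mul_simpleV => m k /m ne; rewrite expVgn => h; apply: ne.
by rewrite -[LHS]invgK h invg1.
Qed.

Lemma inversion_power n x : inversion ((s * s') ^+ n) x =
  \big[addb/false]_(j < n.*2) (x == (s * s') ^+ j * s).
Proof.
rewrite -word_prod_nseq (inversion_word cox).
  by rewrite word_inversion_nseq //; apply: (simple_sqr cox).
by elim: n => //= n IH; apply/word_cons; split=> //; apply/word_cons; split.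
Qed.

Lemma infinite_inversion_power n : infinite_order (s * s') ->
  inversion ((s * s') ^+ n) s' = false.
Proof.
move=> inf; rewrite inversion_power big1 // => j _; apply/eqP => e.
apply: (inf j.+1 isT); rewrite expgSr mulgA -e.
exact: (simple_sqr cox).
Qed.

Lemma infinite_inversion_alternating n : infinite_order (s * s') ->
  inversion (s' * (s * s') ^+ n) s = false.
Proof.
move=> inf; have ne : s <> s'.
  by move=> e; apply: (inf 1%N isT); rewrite e; apply: (simple_sqr cox).
rewrite (inversionM cox) (inversion_simple cox _ Ss') inversion_power.
rewrite big1 ?addbF => [|j _]; first exact/eqP.
apply/eqP => e; apply: (inf j.+2 isT).
rewrite 2!expgSr !mulgA -e conjgE (simpleV cox) // -!mulgA.
by rewrite (simpleK cox _ Ss') (simpleK cox _ Ss) (simple_sqr cox).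
Qed.

End Dihedral.

(** Descents in {s, s'} are those of the dihedral factor of [w], an alternating word; in an infinite
    dihedral group such a word has at most one left descent. *)
Lemma infinite_not_two_descents s s' w : S s -> S s' ->
  infinite_order (s * s') -> inversion w s -> inversion w s' -> False.
Proof.
move=> Ss Ss' inf; have inf' := infinite_order_swap Ss Ss' inf.
have JS : [set s; s'] `<=` S by move=> x [] ->.
have [d [y [Jd _ _ ez]]] := coset_decomposition JS w.
have es x : [set s; s'] x -> inversion w x = inversion d x.
  by move=> Jx; apply: ez; [apply/simple_reflection/JS|apply: generated_letter].
rewrite !es; [|by right|by left].
have [n [] ->] := alternating_dihedral Ss Ss' Jd.
- by rewrite (infinite_inversion_power Ss Ss').
- by rewrite (infinite_inversion_power Ss' Ss).
- by rewrite (infinite_inversion_alternating Ss' Ss).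
- by rewrite (infinite_inversion_alternating Ss Ss').
Qed.

Section Swap.
Variables t s s' : W.
Hypotheses (rt : reflection t) (Ss : S s) (Ss' : S s') (st : s ^ t = s').

Lemma swap_sym : s' ^ t = s.
Proof. by rewrite -st -conjgM (reflection_sqr cox rt) conjg1. Qed.

(** Expanding both sides of t s' = s t by the cocycle rule, the contributions of [s] and [s'] agree
    and cancel. *)
Lemma swap_inversion x : inversion t (x ^ s) = inversion t x.
Proof.
have e : t * s' = s * t by rewrite -st conjgE mulVKg.
have := inversionM cox t s' x; rewrite e (inversionM cox).
rewrite (inversion_simple cox _ Ss) (inversion_simple cox _ Ss') eq_conjg.
rewrite (reflectionV cox rt) swap_sym.
by do 2 case: inversion; case: (x == s).
Qed.

End Swap.

(** Starting from [t], an inversion of itself, conjugate alternately by the two swapped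
    generators. *)
Lemma swap_inversion_power t s s' n : reflection t -> S s -> S s' ->
  s ^ t = s' -> inversion t (t * (s * s') ^+ n).
Proof.
move=> rt; elim: n s s' => [|n IH] s s' Ss Ss' st.
  by rewrite mulg1 inversion_id.
have ts := swap_sym rt st.
have <- : (t * (s' * s) ^+ n) ^ s' = t * (s * s') ^+ n.+1.
  have e : s' * t = t * s by rewrite -ts conjgE mulVKg.
  rewrite conjgE (simpleV cox Ss') !mulgA e expgS -!mulgA; congr (_ * (_ * _)).
  elim: n {IH} => [|n IHn]; first by rewrite mul1g mulg1.
  by rewrite [in LHS]expgS -!mulgA IHn [in RHS]expgS -!mulgA.
by rewrite (swap_inversion rt Ss' Ss ts) IH.
Qed.

(** For n = 2h, the involution [(s * s') ^+ h] would commute with [t], and its product with [t]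
    would be an inversion of [t]. By [inversion_commute] that product is [t], so the involution is
    trivial, against the order. *)
Lemma even_order_not_swap t s s' n : reflection t -> S s -> S s' ->
  has_order (s * s') n -> ~~ odd n -> s ^ t <> s'.
Proof.
move=> rt Ss Ss' [n0 e m] ev st.
have {}ev : n = (n./2).*2 by rewrite -{1}(odd_double_half n) (negPf ev).
set h := n./2 in ev; have hn : (0 < h < n)%N by lia.
have ts := swap_sym rt st.
have AA : (s * s') ^+ h * (s * s') ^+ h = 1 by rewrite -expgnDr addnn -ev.
have := swap_inversion_power h rt Ss Ss' st; rewrite (inversion_commute cox) //.
  move=> /eqP/esym; rewrite -{1}[t]mulg1 => /mulgI/esym; exact: m.
rewrite conjMg conjXg conjMg st ts conjgE mulKg -(mul_simpleV Ss Ss') expVgn.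
by congr (_ * _); apply: mulg1_eq.
Qed.

End Parabolic.

(** * Reflections fixed by the automorphism *)

Section FixedReflections.
Variables (W : groupType) (S : set W) (theta : {multiplicative W -> W}).
Hypotheses (cox : coxeter_system S) (aut : coxeter_automorphism S theta).
Hypotheses (thK : involutive theta).
Implicit Types (f p r s t u v w x y : W).
Local Notation len := (len cox).
Local Notation inversion := (inversion cox).
Local Notation reflection := (reflection S).

Lemma autM x y : theta (x * y) = theta x * theta y.
Proof. exact: gmulfM. Qed.

Lemma aut1 : theta 1 = 1.
Proof. by apply: (@mulgI _ (theta 1)); rewrite -autM !mulg1. Qed.

Lemma autV x : theta x^-1 = (theta x)^-1.
Proof. by apply/esym/mulg1_eq; rewrite -autM mulgV aut1. Qed.

Lemma autJ x y : theta (x ^ y) = theta x ^ theta y.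
Proof. by rewrite !autM autV. Qed.

Lemma autX x n : theta (x ^+ n) = theta x ^+ n.
Proof. by elim: n => [|n IH]; rewrite ?aut1 // !expgS autM IH. Qed.

Lemma simple_aut s : S s -> S (theta s).
Proof. by case: aut => _ {2}<- Ss; exists s. Qed.

Lemma reflection_aut t : reflection t -> reflection (theta t).
Proof.
by case=> s Ss [x ->]; rewrite autJ; exact/reflectionJ/simple_reflection/simple_aut.
Qed.

Lemma len_aut w : len (theta w) = len w.
Proof.
wlog: w / (len w <= len (theta w))%N => [H|].
  case/orP: (leq_total (len w) (len (theta w))) => h; first exact: H.
  by rewrite -{2}(thK w) (H (theta w)) ?thK.
move=> le; apply/eqP; rewrite eqn_leq le andbT.
have [r [Sr e <-]] := ex_reduced cox w.
have -> : theta w = word_prod (map theta r).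
  rewrite -e; elim: r {Sr e le} => [|x r IH]; first by rewrite word_prod_nil aut1.
  by rewrite /= !word_prod_cons autM IH.
rewrite -(size_map theta r); apply: len_word => x /= /mapP[y yr ->].
exact/simple_aut/Sr.
Qed.

Lemma inversion_aut w t : reflection t ->
  inversion (theta w) (theta t) = inversion w t.
Proof.
move=> rt; rewrite -!(len_refl cox) -?autM ?len_aut //.
exact: reflection_aut.
Qed.

Lemma len_conj_involution s x : S s -> x * x = 1 -> s * x <> x * s ->
  if inversion x s then len x = (len (x ^ s) + 2)%N
  else len (x ^ s) = (len x + 2)%N.
Proof.
move=> Ss xx ne; have xV := mulg1_eq xx.
have := len_two_sided Ss Ss ne; rewrite conjgE (simpleV cox Ss) mulgA; apply.
by rewrite -(lenV cox (x * s)) invgM xV (simpleV cox Ss).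
Qed.

(** * A simple reflection with a distinct image, the two generating a dihedral group of even type *)

Section EvenDihedral.
Variables (s : W) (h : nat).
Let s' := theta s.
Let J : set W := [set s; s'].
Let A := (s * s') ^+ h.
Hypotheses (Ss : S s) (ns : s <> s') (h0 : (0 < h)%N).
Hypothesis ord : has_order (s * s') h.*2.

Let Ss' : S s'. Proof. exact: simple_aut. Qed.
Let JS : J `<=` S. Proof. by move=> x [] ->. Qed.
Let Js : J s. Proof. by left. Qed.
Let Js' : J s'. Proof. by right. Qed.
Let AA : A * A = 1. Proof. by rewrite -expgnDr addnn; case: ord. Qed.
Let AV : A^-1 = A. Proof. exact: mulg1_eq. Qed.

Let A_swap : A = (s' * s) ^+ h.
Proof. by rewrite -(mul_simpleV cox) // expVgn AV. Qed.

Let JA : generated J A.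
Proof. by apply/generatedX/generatedM; apply: generated_letter. Qed.

Let sA : s ^ A = s.
Proof.
have e n : s * (s' * s) ^+ n = (s * s') ^+ n * s.
  elim: n => [|n IH]; first by rewrite mul1g mulg1.
  by rewrite [in LHS]expgSr [in RHS]expgSr !mulgA IH.
by rewrite conjgE {2}A_swap e mulKg.
Qed.

Let s'A : s' ^ A = s'.
Proof.
apply: (@mulgI _ s); rewrite -{1}sA -conjMg; rewrite conjgE /A.
by rewrite -expgS expgSr mulKg.
Qed.

Let thA : theta A = A.
Proof. by rewrite /A autX autM thK -A_swap. Qed.

Let inversion_half x y : S x -> S y -> has_order (x * y) h.*2 ->
  inversion ((x * y) ^+ h) x.
Proof.
move=> Sx Sy [_ _ m]; rewrite (inversion_power cox) //.
case: h h0 m => // k _ m; rewrite doubleS big_ord_recl mul1g eqxx big1 //= => j _.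
apply/eqP => e; apply: (m (bump 0 j)).
  by have := ltn_ord j; rewrite /bump; lia.
by apply: (@mulIg _ x); rewrite mul1g -e.
Qed.

Let inversionA j : J j -> inversion A j.
Proof.
case=> ->; first exact: inversion_half.
by rewrite A_swap; apply: inversion_half => //; apply: (has_order_swap cox).
Qed.

Let conjA j : J j -> j ^ A = j.
Proof. by case=> ->. Qed.

(* t = A y, where A is the longest element of the dihedral group D generated by
   s and theta s. If t ^ A is not shorter than t, then t normalizes D and
   permutes its two simple generators. *)
Let len_conj_longest t : reflection t -> theta t = t -> inversion t s ->
  (len (t ^ A) < len t)%N.
Proof.
move=> rt tht its; rewrite ltnNge; apply/negP => le.
have it j : J j -> inversion t j.
  by case=> -> //; rewrite -{1}tht inversion_aut //; exact: simple_reflection.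
(* Both generators are descents of [t] and of [A], so they cancel in [y], which is thus minimal in
   its left-descent coset and shorter than [t]. *)
pose y := A * t.
have ny j : J j -> ~~ inversion y j.
  by move=> Jj; rewrite (inversionM cox) conjA // it // inversionA.
have ly : (len y < len t)%N.
  apply: (@leq_ltn_trans (len ((s * A) * y))).
    by apply: (coset_minimal JS ny); apply: generatedM => //; apply: generated_letter.
  have -> : s * A * y = s * t by rewrite /y -mulgA (mulgA A) AA mul1g.
  by rewrite (len_refl cox) //; exact: simple_reflection.
have yV : y^-1 = t * A by rewrite invgM AV (reflectionV cox rt).
have At2 : A * t ^ A = y^-1 by rewrite yV conjgE mulVKg.
have tht2 : theta (t ^ A) = t ^ A by rewrite autJ tht thA.
(* If [t ^ A] has no descent in [J], it is minimal in the coset of [A * t ^ A = y^-1], so its length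
   is at most that of [y], hence less than that of [t]. *)
have [i2|ni2] := boolP (inversion (t ^ A) s); last first.
  have n2 j : J j -> ~~ inversion (t ^ A) j.
    by case=> -> //; rewrite -{1}tht2 inversion_aut //; exact: simple_reflection.
  have := coset_minimal JS n2 JA; rewrite At2 lenV => h2.
  by have := leq_ltn_trans (leq_trans le h2) ly; rewrite ltnn.
have i2' j : J j -> inversion (t ^ A) j.
  by case=> -> //; rewrite -{1}tht2 inversion_aut //; exact: simple_reflection.
have nyV j : J j -> ~~ inversion y^-1 j.
  by move=> Jj; rewrite -At2 (inversionM cox) (conjA Jj) (i2' _ Jj) inversionA.
(* In [t = y^-1 * A] the inversion [j] is not one of [y^-1], so its conjugate is an inversion of [A]
   and lies in the dihedral group. *)
have gyV j : J j -> generated J (j ^ y^-1).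
  move=> Jj; apply: (generated_inversion (cox := cox) JS JA).
  have := it j Jj; have {1}-> : t = y^-1 * A by rewrite yV -mulgA AA mulg1.
  by rewrite (inversionM cox) (negPf (nyV j Jj)).
have sy : s ^ y = s ^ t by rewrite conjgM sA.
have gst : generated J (s ^ t).
  have -> : s ^ t = (s ^ y^-1) ^ A by rewrite yV conjgM -conjgM AA conjg1.
  by apply: (generatedJ cox JS) => //; exact: gyV.
(* Write [s ^ t] as [s ^ y]: neither outer factor contributes, so its only possible descent in [J]
   is itself. Being a nontrivial element of the dihedral group, it must therefore be [s] or [s']. *)
have ist x : J x -> inversion (s ^ t) x = (x == s ^ t).
  move=> Jx; have rx := simple_reflection (JS Jx).
  rewrite -sy {1}conjgE (inversionM cox y^-1) (inversionM cox s y).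
  rewrite (negPf (nyV x Jx)) addFb.
  rewrite (inversion_simple cox _ Ss) eq_conjg invgK.
  rewrite (coset_minimal_inversion (cox := cox) JS ny) ?addbF //.
    by do 2 apply: reflectionJ.
  by apply: (generatedJ cox JS); [exact: gyV|exact: generated_letter].
have [e|ne] := eqVneq s (s ^ t).
  have := its; rewrite (inversion_commute cox) // => /eqP et.
  by apply: ns; rewrite /s' et tht.
have [e'|ne'] := eqVneq s' (s ^ t).
  by apply: (even_order_not_swap cox rt Ss Ss' ord) => //; rewrite odd_double.
have : s ^ t = 1.
  apply: (generated_eq1 (cox := cox) JS gst) => j Jj; rewrite ist //.
  by case: Jj => ->.
move/eqP; rewrite conjg_eq1 => /eqP; exact: (simple_neq1 cox Ss).
Qed.

Lemma ex_shorter_conj t : reflection t -> theta t = t -> inversion t s ->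
  exists2 f, theta f = f & (len (t ^ f) < len t)%N.
Proof. by move=> rt tht its; exists A => //; apply: len_conj_longest. Qed.

End EvenDihedral.

Hypothesis nof : NOF S theta.

(** Induction on length: a non-simple [t] is shortened by conjugating with a [theta]-fixed element.
    At a descent [s] of [t], this element is [s] itself if fixed, and otherwise the longest element
    of the dihedral group of [s] and [theta s]. *)
Lemma fixed_reflection t : reflection t -> theta t = t ->
  exists p f, [/\ S p, theta p = p, theta f = f & t = p ^ f].
Proof.
have [n] := ubnP (len t); elim: n t => // n IH t; rewrite ltnS => tn rt tht.
have [s Ss its] : exists2 s, S s & inversion t s.
  apply: ex_left_descent => t1; case: rt t1 => p Sp [x ->] /eqP.
  by rewrite conjg_eq1 => /eqP; exact: (simple_neq1 cox Sp).
suff [[t_s ths]|[f thf lf]] : (t = s /\ theta s = s) \/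
    exists2 f, theta f = f & (len (t ^ f) < len t)%N.
- by exists s, 1; rewrite aut1 conjg1.
- have [|||p [g [Sp thp thg e]]] := IH (t ^ f).
  + exact: leq_trans lf tn.
  + exact: reflectionJ.
  + by rewrite autJ tht thf.
  by exists p, (g * f^-1); rewrite autM autV thg thf conjgM -e conjgK.
have [ths|ths] := eqVneq (theta s) s.
  have [c|ne] := eqVneq (s * t) (t * s).
    left; split=> //; apply/esym/eqP.
    by rewrite -(inversion_commute cox rt) // conjgE c mulKg.
  right; exists s => //.
  have := len_conj_involution Ss (reflection_sqr cox rt); rewrite its.
  by move=> ->; [rewrite addn2|exact/eqP].
right; have ns : s <> theta s by move=> e; rewrite -e eqxx in ths.
(* Both [s] and [theta s] are descents of [t], which excludes infinite order. *)
case: (nof Ss ns) => [inf|[m ord]].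
  exfalso; apply: (infinite_not_two_descents (cox := cox) Ss (simple_aut Ss) inf its).
  by rewrite -tht inversion_aut //; exact: simple_reflection.
move=> ev; have em : m = (m./2).*2 by rewrite -{1}(odd_double_half m) (negPf ev).
rewrite em in ord; apply: (ex_shorter_conj Ss ns _ ord rt tht its).
by case: ord; rewrite double_gt0.
Qed.

(** Conjugating by a fixed element reduces to [t] simple. Were [x] not to commute with it,
    conjugation would change the length by two, whereas [theta] preserves length. *)
Lemma twisted_commute_involution t x : reflection t -> theta t = t ->
  x * x = 1 -> theta x = x ^ t -> theta x = x.
Proof.
move=> rt tht xx e; have [p [f [Sp thp thf et]]] := fixed_reflection rt tht.
pose z := x ^ f^-1.
have zz : z * z = 1 by rewrite -conjMg xx conj1g.
have thz : theta z = z ^ p.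
  by rewrite autJ autV thf e et -!conjgM [p ^ f]conjgE mulgA mulgK.
have [c|ne] := eqVneq (p * z) (z * p).
  have : theta z = z by rewrite thz conjgE -c mulKg.
  by rewrite autJ autV thf => /conjg_inj.
have := len_conj_involution Sp zz (elimN eqP ne); rewrite -thz len_aut.
case: inversion; lia.
Qed.

(** The reflection x s x^-1 is fixed; left multiplication of [x] by a fixed element keeps the
    twisted identity and makes that reflection simple. The factors [theta z^-1] and [z] then
    contribute equal parities. *)
Lemma twisted_identity_ascent x s : S s ->
  theta s * (theta x^-1 * x) = theta x^-1 * x * s ->
  inversion (theta x^-1 * x) (theta s) = false.
Proof.
move=> Ss e.
have es : s ^ (theta x^-1 * x)^-1 = theta s.
  by rewrite conjgE invgK mulgA -e mulgK.
pose t := s ^ x^-1.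
have rt : reflection t by apply/reflectionJ/simple_reflection.
have tht : theta t = t.
  rewrite autJ -es -conjgM; congr (_ ^ _).
  by rewrite invgM mulgVK.
have [p [f [Sp thp thf et]]] := fixed_reflection rt tht.
pose z := f * x.
have ez : theta x^-1 * x = theta z^-1 * z.
  by rewrite /z invgM autM (autV f) thf -!mulgA mulKg.
have sz : s ^ z^-1 = p.
  by rewrite /z invgM conjgM -/t et conjgK.
have rs : reflection s by exact: simple_reflection.
rewrite ez (inversionM cox) inversion_aut //.
have -> : theta s ^ theta z^-1 = p by rewrite -autJ sz.
by rewrite inversionV sz; case: inversion.
Qed.

End FixedReflections.

(** * Twisted identities *)

Section TwistedIdentities.
Variables (W : groupType) (S : set W) (theta : {multiplicative W -> W}).
Hypotheses (cox : coxeter_system S) (aut : coxeter_automorphism S theta).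
Hypotheses (thK : involutive theta) (nof : NOF S theta).
Implicit Types (a b g r s t u v w x y : W).
Local Notation len := (len cox).
Local Notation inversion := (inversion cox).
Local Notation reflection := (reflection S).
Local Notation chain_le := (chain_le cox).
Local Notation iota := (twisted_identities theta).

Lemma chain_le_aut u w : chain_le u w -> chain_le (theta u) (theta w).
Proof.
elim=> [{}u|t {}u {}w rt ni _ IH]; first exact: chain_le_refl.
apply: (@chain_le_step _ _ _ (theta t)); last by rewrite -autM.
  exact: reflection_aut.
by rewrite inversion_aut.
Qed.

Lemma twisted_identity_involution w : iota w -> theta w = w^-1.
Proof. by case=> x _ <-; rewrite autM thK invgM autV invgK. Qed.

Lemma twisted_identity1 : iota 1.
Proof. by exists 1 => //; rewrite mulg1 invg1 aut1. Qed.

Lemma twisted_identity_conj a w : S a -> iota w -> iota (a * w * theta a).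
Proof.
move=> Sa [x _ <-]; exists (x * theta a) => //.
by rewrite invgM autM -autV (simpleV cox Sa) thK !mulgA.
Qed.

(** * Lifting along the doubled step w -> a w theta(a) *)

Section TwistedInvolutions.
Variable a : W.
Hypothesis Sa : S a.

Lemma twist_simpleM w : theta w = w^-1 -> theta (a * w)^-1 = w * theta a.
Proof. by move=> tw; rewrite invgM (simpleV cox Sa) autM autV tw invgK. Qed.

Lemma twist_fix w : theta w = w^-1 -> theta w^-1 = w.
Proof. by move=> tw; rewrite autV tw invgK. Qed.

(** The map u -> theta(u^-1) fixes twisted involutions and turns left multiplication by [a] into
    right multiplication by [theta a]. Each two-sided lift below is a one-sided lift, this map, and
    a second one-sided lift. *)
Lemma chain_le_twist u w : chain_le u w -> chain_le (theta u^-1) (theta w^-1).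
Proof. by move=> /chain_leV/chain_le_aut. Qed.

Lemma inversion_twist w : a * w <> w * theta a ->
  inversion (w * theta a) a = inversion w a.
Proof. by move=> ne; apply: inversion_mul_simple => //; exact: simple_aut. Qed.

Lemma len_conj_simple w : theta w = w^-1 -> a * w <> w * theta a ->
  if inversion w a then len w = (len (a * w * theta a) + 2)%N
  else len (a * w * theta a) = (len w + 2)%N.
Proof.
move=> tw ne; apply: len_two_sided => //; first exact: simple_aut.
by rewrite -(twist_simpleM tw) (len_aut cox aut thK) lenV.
Qed.

Variables u w : W.
Hypotheses (tu : theta u = u^-1) (tw : theta w = w^-1) (uw : chain_le u w).

Lemma le_conj_right : ~~ inversion u a -> inversion w a ->
  a * w <> w * theta a -> chain_le u (a * w * theta a).
Proof.
move=> ni iw ne; have [/chain_le_twist + _] := chain_le_lift_notin Sa uw ni iw.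
rewrite (twist_fix tu) twist_simpleM // -mulgA => h.
by have [] := chain_le_lift_notin Sa h ni; rewrite ?inversion_twist.
Qed.

Lemma le_conj_descent : inversion u a -> a * u <> u * theta a ->
  chain_le (a * u * theta a) (a * w * theta a).
Proof.
move=> iu ne; have /chain_le_twist := chain_le_lift_in Sa uw iu.
rewrite !twist_simpleM // -!mulgA => h.
by apply: (chain_le_lift_in Sa h); rewrite inversion_twist.
Qed.

Lemma le_conj_ascent : ~~ inversion w a -> a * w <> w * theta a ->
  chain_le (a * u * theta a) (a * w * theta a).
Proof.
move=> iw ne; have /chain_le_twist := chain_le_mul Sa uw iw.
rewrite !twist_simpleM // -!mulgA => h.
by apply: (chain_le_mul Sa h); rewrite inversion_twist.
Qed.

Lemma le_conj_left : ~~ inversion u a -> inversion w a ->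
  a * u <> u * theta a -> chain_le (a * u * theta a) w.
Proof.
move=> ni iw ne; have [_ /chain_le_twist] := chain_le_lift_notin Sa uw ni iw.
rewrite (twist_fix tw) twist_simpleM // -mulgA => h.
by have [] := chain_le_lift_notin Sa h _ iw; rewrite ?inversion_twist.
Qed.

Lemma le_conj_commute : ~~ inversion u a -> ~~ inversion w a ->
  a * u <> u * theta a -> a * w = w * theta a ->
  chain_le (a * u * theta a) (a * w).
Proof.
move=> ni niw ne e; have /chain_le_twist := chain_le_mul Sa uw niw.
rewrite !twist_simpleM // -e -mulgA => h.
have ia : inversion (a * w) a.
  by rewrite inversion_reflM //; exact: simple_reflection.
by have [] := chain_le_lift_notin Sa h _ ia; rewrite ?inversion_twist.
Qed.

End TwistedInvolutions.

Lemma twisted_identity_descent a w : S a -> iota w -> inversion w a ->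
  a * w <> w * theta a.
Proof.
move=> Sa [x _ <-] + e.
have := twisted_identity_ascent cox aut thK nof (x := x) (simple_aut aut Sa).
by rewrite thK => /(_ e) ->.
Qed.

(** Conjugate the images of [r] and [g] under [theta] by x^-1, where w = theta(x^-1) x, to get t and
    z. The relations become theta(t) = t and theta(z) = z^t; the conclusion becomes theta(z) = z. *)
Lemma twisted_identity_commute w r g : iota w -> reflection r -> g * g = 1 ->
  r * w = w * theta r -> g * (r * w) = r * w * theta g -> g * w = w * theta g.
Proof.
case=> x _ ew rr gg e1 e2.
have xw : x = theta x * w by rewrite -ew autV mulVKg.
have conjx y : theta y ^ x^-1 = (w * theta y * w^-1) ^ (theta x)^-1.
  by rewrite !conjgE !invgK {1 2}xw invgM !mulgA.
pose t := theta r ^ x^-1; pose z := theta g ^ x^-1.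
have rt : reflection t by apply/reflectionJ/reflection_aut.
have et : t = r ^ (theta x)^-1 by rewrite /t conjx -e1 mulgK.
have tht : theta t = t by rewrite {2}et autJ thK autV.
have ez : theta z = g ^ (theta x)^-1 by rewrite autJ thK autV.
have zz : z * z = 1 by rewrite -conjMg -autM gg aut1 conj1g.
have thz : theta z = z ^ t.
  rewrite ez -conjJg -autJ conjx; congr (_ ^ _).
  rewrite conjgE (reflectionV cox rr) !autM !mulgA -e1 -e2.
  by rewrite -!mulgA (mulgA w) -e1 -!mulgA (reflectionK cox) // mulgV mulg1.
have := twisted_commute_involution cox aut thK nof rt tht zz thz.
by rewrite ez {1}/z conjx => /conjg_inj {1}->; rewrite mulgVK.
Qed.

(* If a w <> w (theta a), then b = r w (theta a) for a reflection r such that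
   r w = w (theta r). *)
Lemma twist_commute_cover a w b : S a -> iota w -> iota b -> chain_le w b ->
  len b = (len w + 2)%N -> ~~ inversion w a -> ~~ inversion b a ->
  a * b = b * theta a -> a * w = w * theta a.
Proof.
move=> Sa iw ib wb lb nw nb e; apply/eqP; apply: contraT => /eqP ne; exfalso.
have tw := twisted_identity_involution iw; have tb := twisted_identity_involution ib.
(* The lengths of [a * w * theta a] and [a * b] exceed that of [w] by 2 and 3, so a single
   reflection joins them. *)
have [t rt et] : exists2 t, reflection t & a * b = t * (a * w * theta a).
  apply: chain_le_cover; first exact: (le_conj_commute Sa tw tb wb).
  have := len_conj_simple Sa tw ne; rewrite (negPf nw) => ->.
  by have := len_simpleM cox b Sa; rewrite (negPf nb) lb.
have [r rr er] : exists2 r, reflection r & b = r * w * theta a.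
  exists (t ^ a); first exact: reflectionJ.
  by rewrite conjgE (simpleV cox Sa) -(simpleK cox b Sa) et -!mulgA.
have er' : b = a * w * theta r.
  rewrite -(twist_fix tb) er !invgM (reflectionV cox rr).
  by rewrite (simpleV cox (simple_aut aut Sa)) !autM thK (twist_fix tw) mulgA.
(* Substitute both expressions for [b] into [a * b = b * theta a]. *)
have ee : r * w = w * theta r.
  have : b * theta a = a * b by [].
  rewrite {1}er er' -!mulgA (simpleK cox _ Sa) (simple_sqr cox) ?mulg1 //.
  exact: simple_aut.
apply: ne; apply: (twisted_identity_commute iw rr (simple_sqr cox Sa) ee).
by rewrite -er ee mulgA -er'.
Qed.

(** A length drop of two is a cover among twisted identities, whose lengths are all even. *)
Definition has_coatoms w : Prop := forall u, iota u -> chain_le u w -> u <> w ->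
  exists v, [/\ iota v, chain_le u v, chain_le v w & len w = (len v + 2)%N].

(** Descend from [b] through coatoms above [u]: [twist_commute_cover] propagates commutation until
    [a] becomes a descent, where [le_conj_left] applies. Reaching [u] would contradict its
    non-commutation. Coatoms are assumed up to the length of [b] because this is used inside the
    induction producing them. *)
Lemma le_conj_of_commute a u b : S a -> iota u -> iota b ->
    (forall w, (len w <= len b)%N -> iota w -> has_coatoms w) ->
    chain_le u b -> ~~ inversion u a -> ~~ inversion b a ->
    a * u <> u * theta a -> a * b = b * theta a ->
  chain_le (a * u * theta a) b.
Proof.
move=> Sa iu; have [n] := ubnP (len b); elim: n b => // n IH b.
rewrite ltnS => bn ib cb ub nu nb neu eb; have tu := twisted_identity_involution iu.
have neb : u <> b by move=> e; rewrite e in neu.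
have [w [iw uw wb lb]] := cb b (leqnn _) ib u iu ub neb.
have tw := twisted_identity_involution iw.
apply: chain_le_trans (wb); have [dw|nw] := boolP (inversion w a).
  exact: (le_conj_left Sa tu tw uw).
apply: IH => //; first by apply: leq_trans bn; rewrite lb addn2.
  by move=> x xw; apply: cb; apply: leq_trans xw _; rewrite lb leq_addr.
exact: (twist_commute_cover Sa iw ib wb).
Qed.

Lemma twisted_identity_coatoms w : iota w -> has_coatoms w.
Proof.
have [n] := ubnP (len w); elim: n w => // n IH w.
rewrite ltnS => wn iw u iu uw neq; have tw := twisted_identity_involution iw.
have tu := twisted_identity_involution iu.
have [a Sa dw] : exists2 a, S a & inversion w a.
  apply: ex_left_descent => w1; apply: neq; apply: (chain_le_len_eq uw).
  by rewrite w1 (eqP (_ : len 1 == 0)%N) // len_eq0.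
have new := twisted_identity_descent Sa iw dw.
have lw := len_conj_simple Sa tw new; rewrite dw in lw.
pose w' := a * w * theta a; have iw' : iota w' by exact: twisted_identity_conj.
have aaK x : a * (a * x * theta a) * theta a = x.
  by rewrite -!mulgA (simpleK cox _ Sa) (simple_sqr cox (simple_aut aut Sa)) mulg1.
have tw' := twisted_identity_involution iw'.
have nw' : ~~ inversion w' a.
  rewrite /w' -mulgA inversion_reflM ?inversion_twist ?dw //.
  exact: simple_reflection.
have lw' : len w = (len w' + 2)%N by [].
have w'w : chain_le w' w.
  apply: (chain_le_trans (v := w * theta a)).
    rewrite /w' -mulgA; apply: chain_le_descent => //.
    by rewrite inversion_twist.
  have /chain_le_twist := chain_le_descent Sa dw.
  by rewrite (twist_fix tw) (twist_simpleM Sa tw).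
(* If [a] is not a descent of [u], the coatom is [w']; otherwise apply the doubled step to both ends
   and use induction below [w']. *)
have [du|nu] := boolP (inversion u a); last first.
  by exists w'; split=> //; exact: (le_conj_right Sa tu tw uw).
have neu := twisted_identity_descent Sa iu du.
have lu := len_conj_simple Sa tu neu; rewrite du in lu.
have uw' := le_conj_descent Sa tu tw uw du neu; rewrite -/w' in uw'.
pose u' := a * u * theta a; rewrite -/u' in lu uw'.
have iu' : iota u' by exact: twisted_identity_conj.
have tu' := twisted_identity_involution iu'.
have nu' : ~~ inversion u' a.
  rewrite /u' -mulgA inversion_reflM ?inversion_twist ?du //.
  exact: simple_reflection.
have eu : a * u' * theta a = u by exact: aaK.
have neu' : a * u' <> u' * theta a.
  rewrite /u' (simpleKr cox _ (simple_aut aut Sa)) -!mulgA (simpleK cox _ Sa).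
  exact: nesym.
have sub x : chain_le x w' -> chain_le x w by move=> h; apply: chain_le_trans w'w.
have len_w' : (len w' < n)%N by apply: leq_trans wn; rewrite lw' addn2.
have nequ' : u' <> w' by move=> e; apply: neq; rewrite -eu e; exact: aaK.
have [v [iv u'v vw' lv]] := IH _ len_w' iw' _ iu' uw' nequ'.
have tv := twisted_identity_involution iv.
have [dv|nv] := boolP (inversion v a).
  exists w'; split=> //; apply: chain_le_trans vw'.
  by rewrite -eu; exact: (le_conj_left Sa tu' tv u'v).
(* In the commuting case [u] still lies below [v], so [w'] is again the coatom; otherwise [v] is
   lifted back by the doubled step. *)
have [ev|/eqP nev] := eqVneq (a * v) (v * theta a).
  exists w'; split=> //; apply: chain_le_trans (vw').
  rewrite -eu; apply: (le_conj_of_commute Sa iu' iv) => // x xv ix.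
  apply: IH ix; apply: leq_ltn_trans xv _; apply: leq_ltn_trans len_w'.
  by rewrite lv leq_addr.
have lav := len_conj_simple Sa tv nev; rewrite (negPf nv) in lav.
exists (a * v * theta a); split; first exact: twisted_identity_conj.
- by rewrite -eu; exact: (le_conj_ascent Sa tu' tv u'v).
- rewrite -(aaK w) -/w'; apply: (le_conj_ascent Sa tv tw' vw') => //.
  rewrite /w' (simpleKr cox _ (simple_aut aut Sa)) -!mulgA (simpleK cox _ Sa).
  exact: nesym.
- by rewrite lw' lv lav.
Qed.

(** Even length ensures that drops by two cannot jump over [k.*2]. *)
Lemma twisted_identity_interpolation u w k : iota u -> iota w -> chain_le u w ->
  (len u <= k.*2 <= len w)%N -> odd (len w) = false ->
  exists v, [/\ iota v, chain_le u v, chain_le v w & len v = k.*2].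
Proof.
move=> iu; have [n] := ubnP (len w); elim: n w => // n IH w.
rewrite ltnS => wn iw uw /andP[uk kw] ow.
have [e|/eqP ne] := eqVneq (len w) k.*2.
  by exists w; split=> //; exact: chain_le_refl.
have neq : u <> w by move=> e; apply: ne; rewrite -e in kw *; lia.
have [v [iv uv vw lv]] := twisted_identity_coatoms iw iu uw neq.
have kv : (k.*2 <= len v)%N by move: ne ow kw; rewrite lv; lia.
have [|||x [ix ux xv lx]] := IH v _ iv uv.
- by apply: leq_trans wn; rewrite lv addn2.
- by rewrite uk.
- by move: ow; rewrite lv oddD addbF.
by exists x; split=> //; apply: chain_le_trans vw.
Qed.

Lemma len_star_expression (r : seq W) : word S r ->
  (len (foldl (star theta) 1%g r) <= (size r).*2)%N.
Proof.
elim/last_ind: r => [|r s IH]; first by rewrite leqn0 len_eq0.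
rewrite -cats1 => /word_cat[Sr /word_cons[Ss _]].
rewrite foldl_cat size_cat addn1 doubleS /=; set x := foldl _ _ _.
have l1 := len_simple cox Ss; have l2 := len_simple cox (simple_aut aut Ss).
have h := IH Sr; rewrite /star; case: ifP => _.
  by apply: (leq_trans (lenM cox _ _)); rewrite l1 addn1 ltnS ltnW.
apply: (leq_trans (lenM cox _ _)); rewrite l1 addn1 ltnS.
by apply: (leq_trans (lenM cox _ _)); rewrite l2 add1n.
Qed.

(** Every descent of a twisted identity lowers the length by exactly two, so removing descents one
    by one attains the lower bound given by [len_star_expression]. *)
Lemma ex_star_expression w : iota w -> exists2 r, star_expression S theta w r &
  len w = (size r).*2.
Proof.
have [n] := ubnP (len w); elim: n w => // n IH w; rewrite ltnS => wn iw.
have [w1|/eqP w1] := eqVneq w 1.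
  by exists [::]; [split|apply/eqP; rewrite w1 len_eq0].
have [a Sa dw] := ex_left_descent cox w1.
have tw := twisted_identity_involution iw.
have ne := twisted_identity_descent Sa iw dw.
have lw := len_conj_simple Sa tw ne; rewrite dw in lw.
have Sa' := simple_aut aut Sa.
have [||r [Sr er] sr] := IH (a * w * theta a).
- by apply: leq_trans wn; rewrite lw addn2.
- exact: twisted_identity_conj.
exists (rcons r (theta a)); last by rewrite lw size_rcons sr doubleS addn2.
split; first by rewrite -cats1; apply/word_cat; split=> //; apply/word_cons.
have e : a * (a * w * theta a) * theta a = w.
  by rewrite mulgA (simpleK cox _ Sa) (simpleKr cox _ Sa').
(* The one-sided branch of [star] would force [w] to equal the shorter element. *)
rewrite foldl_rcons er /star thK e; case: eqP => // h.
by exfalso; move/(congr1 len): h; rewrite lw; lia.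
Qed.

Lemma len_twisted_identity w : iota w -> len w = (rho S theta w).*2.
Proof.
move=> /ex_star_expression[r er lw]; rewrite lw; congr double.
have min (r' : seq W) : star_expression S theta w r' -> (size r <= size r')%N.
  by move=> [Sr' e]; rewrite -leq_double -lw -e len_star_expression.
rewrite /rho; case: xgetP => [k _ [[r' er' <-] min']|/(_ (size r))[]]; last first.
  by split=> //; exists r.
by apply/eqP; rewrite eqn_leq min // min'.
Qed.

End TwistedIdentities.

(** * Maximal chains *)

Section RankedPoset.
Variables (T : Type) (X : set T) (le : T -> T -> Prop) (rk : T -> nat).
Hypothesis po : partial_order_on X le.
Hypothesis rk_lt : forall u v, X u -> X v -> le u v -> u = v \/ (rk u < rk v)%N.
Hypothesis interpolation : forall u v k, X u -> X v -> le u v ->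
  (rk u <= k <= rk v)%N -> exists w, [/\ X w, le u w, le w v & rk w = k].
Implicit Types (u v w : T) (C : set T).

Lemma maximal_chain_mem u v C w : maximal_chain X le u v C ->
  interval X le u v w -> (forall c, C c -> le c w \/ le w c) -> C w.
Proof.
move=> [[CI tot] max] Iw cmp; rewrite -(max (C `|` [set w])); [by right| |by left].
split=> [x [/CI //|->//]|x y [Cx|->] [Cy|->]].
- exact: tot.
- exact: cmp.
- by case: (cmp _ Cy); [right|left].
- by left; case: po => rf _ _; apply: rf; case: Iw.
Qed.

(** If rank [k] were missed, interpolate between the chain elements of nearest rank on either side:
    the new element is comparable with all of [C], against maximality. *)
Lemma maximal_chain_rank u v C k : X u -> X v -> le u v ->
  maximal_chain X le u v C -> (rk u <= k <= rk v)%N -> exists2 c, C c & rk c = k.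
Proof.
move=> Xu Xv uv mC /andP[uk kv]; case: (mC) => -[CI tot] _; case: po => rf _ tr.
have rk_le x y : X x -> X y -> le x y -> (rk x <= rk y)%N.
  by move=> Xx Xy /(rk_lt Xx Xy)[->//|/ltnW].
have Cu : C u.
  apply: (maximal_chain_mem mC); first by split=> //; exact: rf.
  by move=> c /CI[]; right.
have Cv : C v.
  apply: (maximal_chain_mem mC); first by split=> //; exact: rf.
  by move=> c /CI[]; left.
apply: contrapT => none.
have nk c : C c -> rk c <> k by move=> Cc e; apply: none; exists c.
pose lo n := `[< exists2 c, C c & rk c = n >] && (n <= k)%N.
pose hi n := `[< exists2 c, C c & rk c = n >] && (k <= n)%N.
have exlo : exists n, lo n.
  by exists (rk u); apply/andP; split=> //; apply/asboolP; exists u.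
have exhi : exists n, hi n.
  by exists (rk v); apply/andP; split=> //; apply/asboolP; exists v.
have lok n : lo n -> (n <= k)%N by case/andP.
case: (ex_maxnP exlo lok) => _ /andP[/asboolP[c1 C1 <-] k1] max1.
case: (ex_minnP exhi) => _ /andP[/asboolP[c2 C2 <-] k2] min2.
have [X1 u1 _] := CI _ C1; have [X2 _ v2] := CI _ C2.
have lt1 : (rk c1 < k)%N by rewrite ltn_neqAle k1 andbT; apply/eqP/nk.
have c12 : le c1 c2.
  case: (tot _ _ C1 C2) => // /(rk_le _ _ X2 X1) h.
  by have := leq_trans k2 (leq_trans h k1); have := nk _ C1; lia.
have [|w [Xw w1 w2 rw]] := interpolation X1 X2 c12 (k := k); first by rewrite k1.
apply: (nk w) => //; apply: (maximal_chain_mem mC).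
  by split=> //; [apply: (tr u c1)|apply: (tr w c2)].
move=> c Cc; have [Xc _ _] := CI _ Cc.
have [ck|kc] := leqP (rk c) k.
- left; apply: (tr c c1 w) => //; case: (tot _ _ Cc C1) => // h.
  case: (rk_lt X1 Xc h) => [<-|]; first exact: rf.
  rewrite ltnNge max1 //; apply/andP; split=> //; apply/asboolP; by exists c.
- right; apply: (tr w c2 c) => //; case: (tot _ _ Cc C2) => // h.
  case: (rk_lt Xc X2 h) => [->|]; first exact: rf.
  rewrite ltnNge min2 //; apply/andP; split; last exact: ltnW.
  by apply/asboolP; exists c.
Qed.

(** Rank is injective on a chain and, by the previous lemma, takes every value between those of the
    ends. *)
Lemma maximal_chain_card u v C : X u -> X v -> le u v ->
  maximal_chain X le u v C -> C #= `I_(rk v - rk u).+1.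
Proof.
move=> Xu Xv uv mC; case: (mC) => -[CI tot] _.
have rk_le x y : X x -> X y -> le x y -> (rk x <= rk y)%N.
  by move=> Xx Xy /(rk_lt Xx Xy)[->//|/ltnW].
have rkC c : C c -> (rk u <= rk c <= rk v)%N.
  by move=> /CI[Xc uc cv]; rewrite !rk_le.
pose f c := (rk c - rk u)%N.
have -> : `I_(rk v - rk u).+1 = f @` C.
  apply/seteqP; split=> [n /= nv|_ [c /rkC cv <-]]; last by rewrite /f /=; lia.
  have := rk_le _ _ Xu Xv uv => h.
  have [|c Cc e] := maximal_chain_rank Xu Xv uv mC (k := (rk u + n)%N); first by lia.
  by exists c => //; rewrite /f e addKn.
apply/card_esym/inj_card_eq => c d; rewrite !inE => Cc Cd.
have := rkC _ Cc; have := rkC _ Cd; have [Xc _ _] := CI _ Cc; have [Xd _ _] := CI _ Cd.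
rewrite /f => h1 h2 e; have {}e : rk c = rk d by lia.
case: (tot _ _ Cc Cd) => [/(rk_lt Xc Xd)|/(rk_lt Xd Xc)] [->//|]; rewrite e ltnn //.
Qed.

End RankedPoset.

Theorem theorem4p6 (W : groupType) (S : set W)
    (theta : {multiplicative W -> W}) :
  coxeter_system S ->
  finite_set S ->
  coxeter_automorphism S theta ->
  involutive theta ->
  NOF S theta ->
  graded_with_rank (twisted_identities theta) (bruhat S) (rho S theta).
Proof.
move=> cox _ aut thK nof.
have -> : bruhat S = chain_le cox.
  by apply/funext => u; apply/funext => w; apply/propext/bruhatP.
have len_iota := len_twisted_identity cox aut thK nof.
have lt_rank u v : twisted_identities theta u -> twisted_identities theta v ->
    chain_le cox u v -> u = v \/ (rho S theta u < rho S theta v)%N.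
  move=> iu iv uv; case: ltnP => h; [by right|left; apply: (chain_le_len_eq uv)].
  by rewrite !len_iota // leq_double.
have po : partial_order_on (twisted_identities theta) (chain_le cox).
  split=> [x _|x y _ _ xy /chain_le_len yx|x y z _ _ _]; first exact: chain_le_refl.
    exact: chain_le_len_eq xy yx.
  exact: chain_le_trans.
have interp u v k : twisted_identities theta u -> twisted_identities theta v ->
    chain_le cox u v -> (rho S theta u <= k <= rho S theta v)%N ->
    exists w, [/\ twisted_identities theta w, chain_le cox u w,
                  chain_le cox w v & rho S theta w = k].
  move=> iu iv uv h.
  have [||w [iw uw wv e]] :=
    twisted_identity_interpolation aut thK nof (k := k) iu iv uv.
  - by rewrite !len_iota // !leq_double.
  - by rewrite len_iota // odd_double.
  by exists w; split=> //; apply: double_inj; rewrite -len_iota.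
have card := maximal_chain_card po lt_rank interp.
have i1 := twisted_identity1 theta.
split; first split=> //.
- move=> u v _ _; apply: (sub_finite_set _ (finite_chain_le cox v)).
  by move=> w [].
- by exists 1; split=> // w _; exact: chain_le1.
- move=> u v C D iu iv uv mC mD; apply: (card_eq_trans (card _ _ _ iu iv uv mC)).
  exact/card_esym/card.
move=> u x C [iu umin] ix mC.
(* A minimum lies below 1, the least element, so the rank offset in the cardinality is zero. *)
have u1 : u = 1.
  apply: (chain_le_len_eq (umin _ i1)); exact: chain_le_len (chain_le1 cox u).
have := card _ _ _ iu ix (umin _ ix) mC; rewrite u1.
have -> : rho S theta 1 = 0.
  by apply/eqP; rewrite -double_eq0 -len_iota // len_eq0.
by rewrite subn0.
Qed.
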